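(* Let $S$ be a strictly proper scoring rule. Suppose that (i) $\sup_{\theta\in\Omega}\mathcal{R}_S(\delta,\theta)=\sup_{\pi\in\Lambda}R_S(\delta,\pi)$ for all decision rules $\delta$; and (ii) there exists a saddle point $(\delta^\star,\pi^\star)$, with $\delta^\star$ a decision rule and $\pi^\star\in\Lambda$, such that $$R_S(\delta^\star,\pi)\le R_S(\delta^\star,\pi^\star)\le R_S(\delta,\pi^\star)$$ for all decision rules $\delta$ and all $\pi\in\Lambda$. Then there exists $\pi_m\in\Lambda$ which is least favorable with respect to the prior disclosure game with score $S$.
   Context: Setting. $(\Omega,\mathcal{T})$ is a standard Borel parameter space; $\{P_\theta:\theta\in\Omega\}$ is a family of probability measures on a measurable space $(\mathcal{X},\mathcal{A})$ dominated by a $\sigma$-finite measure $\lambda$, with densities $p_\theta=dP_\theta/d\lambda$. $\Lambda$ is a set of probability measures on $(\Omega,\mathcal{T})$ (priors), with the weak topology and its Borel $\sigma$-algebra. For a prior $\pi$, the prior predictive $m^\pi$ is the measure on $\mathcal{X}$ with $\frac{dm^\pi}{d\lambda}(x)=\int_\Omega p_\theta(x)\,d\pi(\theta)$, and $\Pi_x^\pi$ is the Bayes posterior on $\Omega$ given $X=x$, assumed to exist for $m^\pi$-almost all $x$ and to be measurable in $x$. Scores. A scoring rule $S$ assigns to each probability measure $Q$ on $(\Omega,\mathcal{T})$ a measurable function $S(Q,\cdot):\Omega\to\mathbb{R}\cup\{-\infty\}$. It is proper if $\mathbb{E}_{Y\sim P}[S(P,Y)]\ge\mathbb{E}_{Y\sim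 P}[S(Q,Y)]$ for all $P,Q$, and strictly proper if in addition equality implies $Q=P$. Prior disclosure game. A decision rule is a measurable map $\delta:\mathcal{X}\to\Lambda$. The loss is $\ell_S(\theta,x,a)=-S(\Pi_x^a,\theta)$ for $a\in\Lambda$. The frequentist risk is $\mathcal{R}_S(\delta,\theta)=\mathbb{E}_{X\sim P_\theta}[\ell_S(\theta,X,\delta(X))]$. The Bayes risk under $\pi\in\Lambda$ is $R_S(\delta,\pi)=\mathbb{E}_{\Theta\sim\pi}[\mathcal{R}_S(\delta,\Theta)]$. The minimum Bayes risk is $r_S(\pi)=\inf_\delta R_S(\delta,\pi)$ over all decision rules, and $\delta$ is a Bayes rule under $\pi$ if $R_S(\delta,\pi)=r_S(\pi)$. A prior $\pi$ is least favorable if it admits a Bayes rule $\delta_\pi$ such that $\mathcal{R}_S(\delta_\pi,\theta)\le r_S(\pi)$ for all $\theta\in\Omega$. Conventions. The posteriors $\Pi_x^a$ appearing in these definitions are assumed to exist, and the expectations defining the risks are assumed measurable and well defined. *)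

(* Defs.v *)
From HB Require Import structures.
From mathcomp Require Import all_boot all_order all_algebra.
From mathcomp Require Import all_classical all_reals all_analysis.
From mathcomp Require Import measurable_realfun.

Set Implicit Arguments.
Unset Strict Implicit.
Unset Printing Implicit Defensive.

Import Order.TTheory GRing.Theory Num.Theory.
Import numFieldNormedType.Exports.

Local Open Scope classical_set_scope.
Local Open Scope ring_scope.

HB.mixin Record Topological_isBorel d T of Measurable d T & Topological T := {
  measurable_borelE :
    (@measurable d T : set (set T)) = <<s [set U : set T | open U] >>
}.

#[short(type="borelType")]
HB.structure Definition Borel d :=
  {T of Measurable d T & Topological T & Topological_isBorel d T}.

Definition separable (T : topologicalType) : Prop :=
  exists2 D : set T, countable D & dense D.

Definition completely_metrizable (R : realType) (T : topologicalType) : Prop :=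
  exists (M : metricType R) (f : T -> M) (g : M -> T),
    [/\ continuous f, continuous g, cancel f g, cancel g f &
        forall F : set_system M, ProperFilter F -> cauchy F -> exists l : M, F --> l].

Definition polish (R : realType) (T : topologicalType) : Prop :=
  separable T /\ completely_metrizable R T.

(* Two terms of type [probability T R] may differ on non-measurable sets only;
   mathematically they are then the same probability measure, so this relation,
   and not Leibniz equality, is equality of probability measures. Functions of
   a probability measure (scores, posteriors) must accordingly respect it. *)
Definition same_prob d (T : measurableType d) (R : realType)
    (P Q : probability T R) : Prop :=
  forall A : set T, measurable A -> P A = Q A.

Definition bounded_continuous (R : realType) (T : topologicalType) : Type :=
  {f : T -> R | continuous f /\ exists M : R, forall x, `|f x| <= M}.

(* The weak topology is the initial topology of P |-> (f |-> \int f dP),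
   f ranging over the bounded continuous functions. *)
Definition integral_map (R : realType) d (Omega : borelType d)
    (P : probability Omega R) : {ptws bounded_continuous R Omega -> R} :=
  fun f => Rintegral P setT (sval f).

Definition weak_probability (R : realType) d (Omega : borelType d) : Type :=
  initial_topology (@integral_map R d Omega).

HB.instance Definition _ (R : realType) d (Omega : borelType d) :=
  Topological.copy (weak_probability R Omega)
    (initial_topology (@integral_map R d Omega)).

Section expectations.
Local Open Scope ereal_scope.
Context d (T : measurableType d) (R : realType).

(* Excludes +oo - oo, to which the library's integral gives a default value. *)
Definition expectation_defined (P : probability T R) (f : T -> \bar R) : Prop :=
  measurable_fun [set: T] f /\
  (\int[P]_x (f^\+ x) < +oo \/ \int[P]_x (f^\- x) < +oo).

Definition expect (P : probability T R) (f : T -> \bar R) : \bar R :=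
  \int[P]_x f x.

Definition scoring_rule (S : probability T R -> T -> \bar R) : Prop :=
  [/\ forall Q, measurable_fun [set: T] (S Q),
      forall Q t, S Q t != +oo &
      forall P Q, same_prob P Q -> S P = S Q].

Definition proper_score (S : probability T R -> T -> \bar R) : Prop :=
  [/\ scoring_rule S,
      forall P Q, expectation_defined P (S Q) &
      forall P Q, expect P (S Q) <= expect P (S P)].

Definition strictly_proper_score (S : probability T R -> T -> \bar R) : Prop :=
  proper_score S /\
  forall P Q, expect P (S P) = expect P (S Q) -> same_prob Q P.

End expectations.

Section bayes.
Local Open Scope ereal_scope.
Context (R : realType) d (Omega : borelType d) d' (X : measurableType d').
Variable lambda : {sigma_finite_measure set X -> \bar R}.

Definition is_density (P : probability X R) (p : X -> R) : Prop :=
  [/\ measurable_fun [set: X] p, forall x, (0 <= p x)%R &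
      forall A, measurable A -> P A = \int[lambda]_(x in A) (p x)%:E].

Definition predictive_density (p : Omega -> X -> R) (pi : probability Omega R)
    (x : X) : \bar R :=
  \int[pi]_theta (p theta x)%:E.

Definition is_prior_predictive (p : Omega -> X -> R) (pi : probability Omega R)
    (m : {measure set X -> \bar R}) : Prop :=
  [/\ forall x, measurable_fun [set: Omega] (p ^~ x),
      measurable_fun [set: X] (predictive_density p pi) &
      forall A, measurable A ->
        m A = \int[lambda]_(x in A) predictive_density p pi x].

Definition bayes_formula (p : Omega -> X -> R) (pi : probability Omega R)
    (x : X) (Q : probability Omega R) : Prop :=
  0 < predictive_density p pi x < +oo /\
  forall B, measurable B ->
    Q B = (\int[pi]_(theta in B) (p theta x)%:E) / predictive_density p pi x.

(* Pi is a total function of x: a fixed version of the posterior, which Bayes'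
   formula determines outside an m-null set only. *)
Definition is_posterior (p : Omega -> X -> R) (pi : probability Omega R)
    (m : {measure set X -> \bar R}) (Pi : X -> probability Omega R) : Prop :=
  measurable_fun [set: X] (Pi : X -> pprobability Omega R) /\
  {ae m, forall x, bayes_formula p pi x (Pi x)}.

End bayes.

Section disclosure_game.
Local Open Scope ereal_scope.
Context (R : realType) d (Omega : borelType d) d' (X : measurableType d').
Variable P : Omega -> probability X R.
Variable Lambda : set (weak_probability R Omega).
Variable Pi : probability Omega R -> X -> probability Omega R.
Variable S : probability Omega R -> Omega -> \bar R.

(* Measurable for the Borel sets of the subspace topology on Lambda. *)
Definition decision_rule (delta : X -> Lambda) : Prop :=
  forall B : set Lambda, <<s [set U : set Lambda | open U] >> B ->
    measurable (delta @^-1` B).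

Definition loss (theta : Omega) (x : X) (a : probability Omega R) : \bar R :=
  - S (Pi a x) theta.

Definition risk (delta : X -> Lambda) (theta : Omega) : \bar R :=
  expect (P theta) (fun x => loss theta x (set_val (delta x))).

Definition bayes_risk (delta : X -> Lambda) (pi : probability Omega R) : \bar R :=
  expect pi (risk delta).

Definition min_bayes_risk (pi : probability Omega R) : \bar R :=
  ereal_inf [set bayes_risk delta pi | delta in decision_rule].

Definition bayes_rule (delta : X -> Lambda) (pi : probability Omega R) : Prop :=
  decision_rule delta /\ bayes_risk delta pi = min_bayes_risk pi.

Definition least_favorable (pi : probability Omega R) : Prop :=
  exists2 delta, bayes_rule delta pi &
    forall theta, risk delta theta <= min_bayes_risk pi.

Definition risks_defined : Prop :=
  forall delta, decision_rule delta ->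
    (forall theta, expectation_defined (P theta)
       (fun x => loss theta x (set_val (delta x)))) /\
    (forall pi, Lambda pi -> expectation_defined pi (risk delta)).

End disclosure_game.

(* Main.v *)
Require Import Defs.
From HB Require Import structures.
From mathcomp Require Import all_boot all_order all_algebra.
From mathcomp Require Import all_classical all_reals all_analysis.
From mathcomp Require Import measurable_realfun.

(** The saddle prior is itself least favorable, and the saddle rule is its
    witness. By the right half of the saddle inequality the saddle rule minimizes
    the Bayes risk under the saddle prior, so it is a Bayes rule there and the
    saddle value is the minimum Bayes risk. By the left half the same value bounds
    the Bayes risk of the saddle rule under every prior, and the equality of the
    two suprema carries this bound from priors in [Lambda] to single parameters;
    this transfer is needed because [Lambda] may lack the point masses. *)

Set Implicit Arguments.
Unset Strict Implicit.
Unset Printing Implicit Defensive.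

Import Order.TTheory GRing.Theory Num.Theory.
Import numFieldNormedType.Exports.

Local Open Scope classical_set_scope.
Local Open Scope ring_scope.
Local Open Scope ereal_scope.

Theorem lemma4p2 (R : realType)
  (d : measure_display) (Omega : borelType d) (hOmega : polish R Omega)
  (d' : measure_display) (X : measurableType d')
  (lambda : {sigma_finite_measure set X -> \bar R})
  (P : Omega -> probability X R) (p : Omega -> X -> R)
  (hdom : forall theta, P theta `<< lambda)
  (hp : forall theta, is_density lambda (P theta) (p theta))
  (Lambda : set (weak_probability R Omega))
  (m : probability Omega R -> {measure set X -> \bar R})
  (hm : forall pi, Lambda pi -> is_prior_predictive lambda p pi (m pi))
  (Pi : probability Omega R -> X -> probability Omega R)
  (hPi : forall pi, Lambda pi -> is_posterior p pi (m pi) (Pi pi))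
  (hPi_ext : forall pi pi', Lambda pi -> Lambda pi' -> same_prob pi pi' ->
    forall x, same_prob (Pi pi x) (Pi pi' x))
  (S : probability Omega R -> Omega -> \bar R)
  (hS : strictly_proper_score S)
  (hrisk : risks_defined P Lambda Pi S)
  (h_sup : forall delta : X -> Lambda, decision_rule delta ->
    ereal_sup [set risk P Pi S delta theta | theta in [set: Omega]] =
    ereal_sup [set bayes_risk P Pi S delta pi | pi in Lambda])
  (h_saddle : exists (delta_star : X -> Lambda) (pi_star : probability Omega R),
    [/\ decision_rule delta_star, Lambda pi_star,
        forall pi, Lambda pi ->
          bayes_risk P Pi S delta_star pi <= bayes_risk P Pi S delta_star pi_star &
        forall delta : X -> Lambda, decision_rule delta ->
          bayes_risk P Pi S delta_star pi_star <= bayes_risk P Pi S delta pi_star]) :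
  exists2 pi_m : probability Omega R,
    Lambda pi_m & least_favorable P Lambda Pi S pi_m.
Proof.
have [delta [pi [delta_rule Lpi le_value value_le]]] := h_saddle.
have value_min : bayes_risk P Pi S delta pi = min_bayes_risk P Lambda Pi S pi.
  apply/eqP; rewrite eq_le; apply/andP; split.
    by apply: le_ereal_inf_tmp => _ [delta' delta'_rule <-]; exact: value_le.
  by apply: ereal_inf_lbound; exists delta.
exists pi => //; exists delta => // theta.
rewrite -value_min.
apply: (@le_trans _ _ (ereal_sup [set risk P Pi S delta t | t in [set: Omega]])).
  by apply: ereal_sup_ubound; exists theta.
rewrite h_sup//.
by apply: ge_ereal_sup => _ [pi' Lpi' <-]; exact: le_value.
Qed.
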